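(* Let $m,n$ be positive integers, let $\kappa=2^{1-m-n}((m+n)!)^2$, let $f$ be a positive continuous decreasing function on $\mathbb{R}_+$ with inverse function $f^{-1}$ and $f(T)\to0$ as $T\to\infty$, and let $g(T)=\dfrac1{f^{-1}(1/T)}$. Let $\Theta$ be a real $n\times m$ matrix such that $\Theta^\top$ is not $f$-Dirichlet. Then the set $\widehat{\mathbf{BA}}^{\Theta}_{n,m}\left[g\circ\frac1{\kappa^m}\right]$, where $\left(g\circ\frac1{\kappa^m}\right)(T)=g(T/\kappa^m)$, has Lebesgue measure zero in $\mathbb{R}^n$. If in addition there is $\gamma>0$ such that $f(CT)\le C^{-\gamma}f(T)$ for all $T>0$ and all sufficiently large $C>1$, then the set $\widehat{\mathbf{BA}}^{\Theta}_{n,m}[g]$ has Lebesgue measure zero.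
   Context: $|\cdot|$ is the supremum norm; $\|\mathbf v\|_{\mathbb{Z}^k}=\min_{\mathbf p\in\mathbb{Z}^k}|\mathbf v-\mathbf p|$. A real $a\times b$ matrix $\Phi$ is $F$-Dirichlet if for all sufficiently large $T$ there is $\mathbf x\in\mathbb{Z}^b\setminus\{\mathbf 0\}$ with $\|\Phi\mathbf x\|_{\mathbb{Z}^a}^a\le F(T)$ and $|\mathbf x|^b\le T$ (for $\Theta^\top$: $a=m$, $b=n$). For a positive function $h$ (defined for large arguments), $\widehat{\mathbf{BA}}^{\Theta}_{n,m}[h]$ is the set of $\pmb\eta\in\mathbb{R}^n$ with $\liminf_{|\mathbf q|\to\infty,\ \mathbf q\in\mathbb{Z}^m}\dfrac{\|\Theta\mathbf q-\pmb\eta\|_{\mathbb{Z}^n}^n}{h(|\mathbf q|^m)}>0$. *)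

(* Defs.v *)
From mathcomp Require Export all_boot all_order all_algebra.
From mathcomp Require Export all_classical all_reals all_analysis.
Export Order.TTheory GRing.Theory Num.Theory.
Export numFieldNormedType.Exports.

Set Implicit Arguments.
Unset Strict Implicit.
Unset Printing Implicit Defensive.

#[global] Open Scope classical_set_scope.
#[global] Open Scope ring_scope.

Definition intvec {R : realType} k (p : 'cV[int]_k) : 'cV[R]_k :=
  map_mx intr p.

(* The norm `|_| on matrices is the supremum norm. The infimum is over a
   translate of the lattice Z^k, so it is a minimum. *)
Definition dist_int {R : realType} k (v : 'cV[R]_k) : R :=
  inf (range (fun p : 'cV[int]_k => `|v - intvec p|)).

Definition Dirichlet {R : realType} a b (F : R -> R) (Phi : 'M[R]_(a, b)) :
    Prop :=
  \forall T \near +oo, exists x : 'cV[int]_b,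
    [/\ x != 0, dist_int (Phi *m intvec x) ^+ a <= F T
      & `|intvec x : 'cV[R]_b| ^+ b <= T].

(* The filter "|q| --> +oo" on Z^m. *)
Definition intvec_infty (R : realType) m : set_system 'cV[int]_m :=
  filter_from [set: R] (fun M => [set q | M < `|intvec q : 'cV[R]_m|]).
Arguments intvec_infty : clear implicits.

(* Only the values of h at large arguments matter. The lower limit is taken in
   \bar R, since it may be +oo. limf_einf does not use the topology of its
   domain, but its type asks for one. *)
Definition BAhat {R : realType} n m (Theta : 'M[R]_(n, m)) (h : R -> R) :
    set 'cV[R]_n :=
  [set eta | (0 < @limf_einf _ (discrete_topology 'cV[int]_m) R
    (fun q : 'cV[int]_m =>
       (dist_int (Theta *m intvec q - eta) ^+ n
        / h (`|intvec q : 'cV[R]_m| ^+ m))%:E)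
    (intvec_infty R m))%E].

Definition box {R : realType} n (a b : 'cV[R]_n) : set 'cV[R]_n :=
  [set x | forall i, a i 0 <= x i 0 <= b i 0].

(* Lebesgue outer measure on R^n; a set has Lebesgue measure zero (for the
   completed measure) exactly when its outer measure is 0. *)
Definition lebesgue_outer {R : realType} n (A : set 'cV[R]_n) : \bar R :=
  ereal_inf [set v | exists a b : nat -> 'cV[R]_n,
    [/\ forall k i, a k i 0 <= b k i 0,
        A `<=` \bigcup_k box (a k) (b k)
      & v = (\sum_(0 <= k <oo) (\prod_i (b k i 0 - a k i 0))%:E)%E]].

Definition lebesgue_null {R : realType} n (A : set 'cV[R]_n) : Prop :=
  lebesgue_outer A = 0%E.

Definition kappa (R : realType) (m n : nat) : R :=
  2 ^ (1 - m%:Z - n%:Z) * ((m + n)`!%:R) ^+ 2.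

(* The function g associated with f; finv is the inverse of f, so the value is
   meaningful once 1/T lies in the range of f, i.e. for large T. *)
Definition dual_rate {R : realType} (finv : R -> R) (T : R) : R :=
  1 / finv (1 / T).

(* Main.v *)
From HB Require Import structures.
Require Import Defs.
From mathcomp Require Import ring lra.

Set Implicit Arguments.
Unset Strict Implicit.
Unset Printing Implicit Defensive.

(** Suppose that at some large scale [T] no nonzero integer vector [x] satisfies
the Dirichlet condition for [Theta^T], and put [X = T^(1/n)], [Y = f(T)^(1/m)]. The
lattice of the vectors [(x / X, (Theta^T x - y) / Y)] then has no short nonzero
vector, and by transference its dual lattice is dense at a bounded scale: for
every target [eta] there are integer vectors [q], [p] with
[|Theta q - eta - p| <= kappa / X] and [|q| <= kappa / Y]
(inhomogeneous_transference).

Transference is proved by an induction on the dimension which projects along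
an almost shortest vector (small_character_rep). It bounds the covering radius
by [sqrt (2^(m+n) - 1) / 2], which is less than half of [kappa]. The
remaining room allows [q] to be chosen with [|q|] above any fixed bound
(transference_large), so that only large [q] have to be considered.

A point of [BAhat] stays at distance at least [delta^(1/n) / X] from the points
[Theta q - p] obtained in this way, for a constant [delta] that depends on the
point. For a fixed [delta] such points form a set which, at each of the
scales [1 / X], misses in every ball of radius [kappa / X] a smaller ball whose
radius is a fixed proportion of it (repelled_porous). As [X] can be taken
arbitrarily large, such a set is null (porous_null): recutting a finite cover
by cubes at such a scale saves a fixed proportion of its volume, and this can
be repeated. [BAhat] is a countable union of sets of this kind (BAhat_null).

For the translation between [f] and [g] put [S = |q|^m]. By monotonicity,
[S f(T) <= kappa^m] means that [T] is at least the reciprocal of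
[g (S / kappa^m)], the preimage of [kappa^m / S] under [f]; such a preimage
exists for large [S] by the intermediate value theorem. *)

(** * Integer multiples and nearest integers *)

Lemma morphB_intmul (A B : zmodType) (f : A -> B) :
  {morph f : x y / x - y} -> forall z k, f (z *~ k) = f z *~ k.
Proof.
move=> fB z k.
pose F : {additive A -> B} := HB.pack f (GRing.isZmodMorphism.Build A B f fB).
exact: (raddfMz F).
Qed.

Lemma near_int (R : realType) (x : R) : exists k : int, `|x - k%:~R| <= 1 / 2.
Proof.
exists (Num.floor (x + 1 / 2)).
have /andP[] := floor_itv (x + 1 / 2); rewrite intrD /= => h1 h2.
by rewrite ler_norml; lra.
Qed.

(** * The dot product and orthogonal projection along a vector *)

Section Dot.
Variables (R : realType) (N : nat).
Implicit Types u v w : 'rV[R]_N.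

Definition dot u v : R := (u *m v^T) 0 0.

Lemma dotE u v : dot u v = \sum_i u 0 i * v 0 i.
Proof. by rewrite /dot mxE; apply: eq_bigr => i _; rewrite mxE. Qed.

Lemma dotC u v : dot u v = dot v u.
Proof. by rewrite !dotE; apply: eq_bigr => i _; rewrite mulrC. Qed.

Lemma dotDl u v w : dot (u + v) w = dot u w + dot v w.
Proof. by rewrite /dot mulmxDl mxE. Qed.

Lemma dotBl u v w : dot (u - v) w = dot u w - dot v w.
Proof. by rewrite /dot mulmxBl !mxE. Qed.

Lemma dotZl a u v : dot (a *: u) v = a * dot u v.
Proof. by rewrite /dot -scalemxAl mxE. Qed.

Lemma dotDr u v w : dot w (u + v) = dot w u + dot w v.
Proof. by rewrite dotC dotDl !(dotC w). Qed.

Lemma dotBr u v w : dot w (u - v) = dot w u - dot w v.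
Proof. by rewrite dotC dotBl !(dotC w). Qed.

Lemma dotZr a u v : dot u (a *: v) = a * dot u v.
Proof. by rewrite dotC dotZl dotC. Qed.

Lemma dot0l u : dot 0 u = 0.
Proof. by rewrite /dot mul0mx mxE. Qed.

Lemma dot_ge0 u : 0 <= dot u u.
Proof. by rewrite dotE sumr_ge0 // => i _; rewrite -expr2 sqr_ge0. Qed.

Lemma sqr_coord_le_dot u i : u 0 i ^+ 2 <= dot u u.
Proof.
rewrite dotE (bigD1 i) //= -expr2 lerDl sumr_ge0 // => j _.
by rewrite -expr2 sqr_ge0.
Qed.

Lemma dot_gt0 u : u != 0 -> 0 < dot u u.
Proof.
rewrite lt_def dot_ge0 andbT; apply: contra => /eqP u0.
apply/eqP/rowP => i; rewrite mxE; apply/eqP; rewrite -sqrf_eq0.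
by rewrite eq_le sqr_ge0 andbT -u0 sqr_coord_le_dot.
Qed.

Variable w : 'rV[R]_N.

Definition proj : 'M[R]_N := 1%:M - (dot w w)^-1 *: (w^T *m w).

Lemma projE u : u *m proj = u - (dot u w / dot w w) *: w.
Proof.
rewrite /proj mulmxBr mulmx1 -scalemxAr mulmxA (mx11_scalar (u *m w^T)).
by rewrite mul_scalar_mx scalerA mulrC.
Qed.

Hypothesis w_neq0 : w != 0.

Let ww_neq0 : dot w w != 0. Proof. by rewrite gt_eqF // dot_gt0. Qed.

Lemma projw : w *m proj = 0.
Proof. by rewrite projE divff // scale1r subrr. Qed.

Lemma dot_projl u : dot (u *m proj) w = 0.
Proof. by rewrite projE dotBl dotZl divfK // subrr. Qed.

Lemma proj_sym u v : dot (u *m proj) v = dot u (v *m proj).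
Proof. by rewrite !projE dotBl dotBr dotZl dotZr (dotC w v); ring. Qed.

Lemma dot_proj u :
  dot (u *m proj) (u *m proj) = dot u u - dot u w ^+ 2 / dot w w.
Proof.
rewrite {2}projE dotBr dotZr dot_projl mulr0 subr0 projE dotBl dotZl (dotC w u).
by rewrite expr2; ring.
Qed.

Lemma rank_proj (U : 'M[R]_N) k : (w <= U)%MS -> (\rank U <= k.+1)%N ->
  (\rank (U *m proj) <= k)%N.
Proof.
move=> wU Uk; rewrite -ltnS; apply: leq_trans Uk.
rewrite -(mxrank_mul_ker U proj) -addn1 leq_add2l.
apply: leq_trans (_ : \rank w <= _)%N; first by rewrite rank_rV w_neq0.
by apply: mxrankS; rewrite sub_capmx wU; apply/sub_kermxP; exact: projw.
Qed.

End Dot.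

(** * Characters of a discrete group are induced by short vectors *)

(** The infimum of the squared lengths is positive, so it is attained up to a
factor [4/3]. That is enough for the reduction argument below, and it spares a
proof that the minimum is attained. *)
Lemma near_shortest (R : realType) (A : zmodType) N
    (phi : A -> 'rV[R]_N) (s : R) z1 :
  0 < s -> (forall z, phi z != 0 -> s <= dot (phi z) (phi z)) ->
  phi z1 != 0 ->
  exists z0, [/\ phi z0 != 0, s <= dot (phi z0) (phi z0) &
    forall z, phi z != 0 ->
      3 / 4 * dot (phi z0) (phi z0) <= dot (phi z) (phi z)].
Proof.
move=> s0 hs h1.
pose S := [set x | exists2 z, phi z != 0 & x = dot (phi z) (phi z)].
have lbS : lbound S s by move=> _ [z zn0 ->]; exact: hs.
have Sn0 : has_inf S by split; [exists (dot (phi z1) (phi z1)), z1 | exists s].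
have sS : s <= inf S by apply: lb_le_inf => //; case: Sn0.
have [|x [z0 z0n0 ->] h] := inf_adherent (eps := inf S / 3) _ Sn0.
  by rewrite divr_gt0 //; lra.
exists z0; split=> //; first exact: hs.
move=> z zn0.
have : inf S <= dot (phi z) (phi z) by apply: ge_inf; [case: Sn0 | exists z].
by lra.
Qed.

(** Read modulo 1, [chi] is a character of the discrete group [phi(A)], and the
lemma finds a short vector inducing it. This is the transference principle in
disguise: [chi] plays the role of a target point, [phi(A)] that of the dual
lattice, and [y] is the difference between the target and a lattice point, so
the bound on [y] is a bound on the covering radius by the length [s] of the
shortest dual vector.

The induction is on the dimension. A multiple [y1] of an almost shortest vector
[w] induces the right value at [w]. The rest of the character kills [w], hence
lives on the projection of the group to the hyperplane orthogonal to [w].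
Subtracting a multiple of [w] makes the component along [w] at most half of
[w], so a nonzero projection has squared length at least
[3/4 |w|^2 - 1/4 |w|^2 = |w|^2 / 2]. Each dimension thus costs a factor 2, and
the orthogonal contributions sum to [(1 + 2 + ... + 2^(k-1)) / (4 s)]. *)
Lemma small_character_rep (R : realType) (A : zmodType) N k
    (U : 'M[R]_N) (phi : A -> 'rV[R]_N) (chi : A -> R) (s : R) :
  {morph phi : x y / x - y} -> {morph chi : x y / x - y} ->
  0 < s -> (\rank U <= k)%N -> (forall z, (phi z <= U)%MS) ->
  (forall z, phi z != 0 -> s <= dot (phi z) (phi z)) ->
  (forall z, phi z = 0 -> chi z \is a Num.int) ->
  exists y, 4 * s * dot y y <= 2 ^+ k - 1 /\
    forall z, dot y (phi z) - chi z \is a Num.int.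
Proof.
elim: k U phi chi s => [|k IH] U phi chi s phiB chiB s0 Uk phiU phis chi0.
  exists 0; split; first by rewrite dot0l mulr0 expr0 subrr.
  move=> z; rewrite dot0l sub0r rpredN chi0 //.
  move: Uk (phiU z); rewrite leqn0 mxrank_eq0 => /eqP ->.
  by rewrite submx0 => /eqP.
have [phi0|] := pselect (forall z, phi z = 0).
  exists 0; split; last by move=> z; rewrite dot0l sub0r rpredN chi0.
  by rewrite dot0l mulr0 subr_ge0 exprn_ege1 // ler1n.
move=> /existsNP[z1 /eqP z1n0].
have [z0 [z0n0 s_le short]] := near_shortest s0 phis z1n0.
set w := phi z0 in z0n0 s_le short; set W := dot w w in s_le short.
have W0 : 0 < W by exact: lt_le_trans s_le.
have [l hl] := near_int (chi z0).
pose y1 : 'rV[R]_N := ((chi z0 - l%:~R) / W) *: w.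
have y1w : dot y1 w = chi z0 - l%:~R by rewrite dotZl divfK // gt_eqF.
pose phi' z := phi z *m proj w.
pose chi' z := chi z - dot y1 (phi z).
have phiZ z j : phi (z - z0 *~ j) = phi z - j%:~R *: w.
  by rewrite phiB (morphB_intmul phiB) scaler_int.
have phi'E z j : phi' (z - z0 *~ j) = phi' z.
  by rewrite /phi' phiZ mulmxBl -scalemxAl projw // scaler0 subr0.
(* Reduction of [phi z] modulo [w]. *)
have dot_lift z : exists j, dot (phi (z - z0 *~ j)) (phi (z - z0 *~ j)) <=
    dot (phi' z) (phi' z) + W / 4.
  have [j hj] := near_int (dot (phi z) w / W).
  exists j; rewrite -(phi'E z j) dot_proj // -/W.
  have -> : dot (phi (z - z0 *~ j)) w = dot (phi z) w - j%:~R * W.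
    by rewrite phiZ dotBl dotZl.
  set a := dot _ w in hj *; set D := dot _ _.
  have -> : (a - j%:~R * W) ^+ 2 / W = (a / W - j%:~R) ^+ 2 * W.
    by field; rewrite gt_eqF.
  have : (a / W - j%:~R) ^+ 2 <= 1 / 4.
    by move: hj; rewrite ler_norml => /andP[]; nra.
  by nra.
have [] := IH (U *m proj w) phi' chi' (W / 2).
- by move=> x y; rewrite /phi' phiB mulmxBl.
- by move=> x y; rewrite /chi' phiB chiB dotBr; ring.
- by lra.
- by apply: rank_proj => //; exact: phiU.
- by move=> z; exact: submxMr.
- move=> z phi'z; have [j hj] := dot_lift z.
  have /short : phi (z - z0 *~ j) != 0.
    by apply: contra phi'z => /eqP h; rewrite -(phi'E z j) /phi' h mul0mx.
  by lra.
(* A vector of the group that is parallel to [w] is a multiple of it: its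
   reduction is at most half as long as [w], hence zero. *)
- move=> z phi'z; have [j hj] := dot_lift z.
  rewrite phi'z dot0l add0r in hj.
  have phij : phi (z - z0 *~ j) = 0.
    by apply/eqP/negP => /negP/short; lra.
  have := chi0 _ phij; rewrite chiB (morphB_intmul chiB) /chi' => hchi.
  have -> : phi z = j%:~R *: w by apply/eqP; rewrite -subr_eq0 -phiZ phij.
  rewrite dotZr y1w.
  have -> : chi z - j%:~R * (chi z0 - l%:~R) =
      (chi z - chi z0 *~ j) + (j * l)%:~R.
    by rewrite intrM -mulrzr; ring.
  by rewrite rpredD // intr_int.
move=> y2 [y2W y2E].
(* [y2] need not be orthogonal to [w], but its projection induces the same
   character on the projected group. *)
exists (y1 + y2 *m proj w); split; last first.
  move=> z; rewrite dotDl proj_sym // -/(phi' z).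
  have -> : dot y1 (phi z) + dot y2 (phi' z) - chi z = dot y2 (phi' z) - chi' z.
    by rewrite /chi'; ring.
  exact: y2E.
have -> : dot (y1 + y2 *m proj w) (y1 + y2 *m proj w) =
    dot y1 y1 + dot (y2 *m proj w) (y2 *m proj w).
  have y10 : dot y1 (y2 *m proj w) = 0 by rewrite dotZl dotC dot_projl ?mulr0.
  by rewrite dotDl !dotDr [dot (y2 *m _) y1]dotC y10 addr0 add0r.
have : dot (y2 *m proj w) (y2 *m proj w) <= dot y2 y2.
  by rewrite dot_proj // gerBl divr_ge0 ?sqr_ge0 ?dot_ge0.
have -> : dot y1 y1 = (chi z0 - l%:~R) ^+ 2 / W.
  by rewrite {1}/y1 dotZl dotC y1w; field; rewrite gt_eqF.
have hc : (chi z0 - l%:~R) ^+ 2 <= 1 / 4.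
  by move: hl; rewrite ler_norml => /andP[]; nra.
have y0 := dot_ge0 (y2 *m proj w).
move: (dot (y2 *m _) _) (dot y2 y2) y0 y2W => p q p0 qW pq.
have : 4 * W * ((chi z0 - l%:~R) ^+ 2 / W + p) <= 2 ^+ k.+1 - 1.
  rewrite mulrDr; have -> : 4 * W * ((chi z0 - l%:~R) ^+ 2 / W) =
     4 * (chi z0 - l%:~R) ^+ 2 by field; rewrite gt_eqF.
  have : W * p <= W * q by rewrite ler_pM2l.
  by rewrite [2 ^+ k.+1]exprS; lra.
apply: le_trans; rewrite ler_wpM2r ?addr_ge0 ?divr_ge0 ?sqr_ge0 ?(ltW W0) //.
by rewrite ler_pM2l.
Qed.

(** * Supremum norm, integer vectors and the distance to the integers *)

Section SupNorm.
Variables (R : realType) (k : nat).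
Implicit Types v : 'cV[R]_k.

Lemma le_cnorm v i : `|v i 0| <= `|v|.
Proof.
rewrite [leRHS]mx_normrE.
exact: (le_bigmax 0 (fun ij : 'I_k * 'I_1 => `|v ij.1 ij.2|) (i, 0)).
Qed.

Lemma cnorm_le v b : 0 <= b -> (forall i, `|v i 0| <= b) -> `|v| <= b.
Proof.
move=> b0 h; rewrite [leLHS]mx_normrE; apply: bigmax_le => // -[i j] _ /=.
by rewrite ord1.
Qed.

Lemma lt_cnorm v b : 0 <= b -> b < `|v| -> exists i, b < `|v i 0|.
Proof.
move=> b0; apply: contraPP => /forallNP h; apply/negP; rewrite -leNgt.
by apply: cnorm_le => // i; rewrite leNgt; apply/negP.
Qed.

Lemma intvecB (p q : 'cV[int]_k) :
  intvec (p - q) = intvec p - intvec q :> 'cV[R]_k.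
Proof. by apply/colP => i; rewrite !mxE intrB. Qed.

Lemma intvecD (p q : 'cV[int]_k) :
  intvec (p + q) = intvec p + intvec q :> 'cV[R]_k.
Proof. by apply/colP => i; rewrite !mxE intrD. Qed.

Lemma intvec0 : intvec 0 = 0 :> 'cV[R]_k.
Proof. by apply/colP => i; rewrite !mxE. Qed.

Lemma intvec_delta i : intvec (delta_mx i 0) = delta_mx i 0 :> 'cV[R]_k.
Proof. by apply/colP => j; rewrite !mxE; case: (_ && _). Qed.

Lemma intvec_of_int v : (forall i, v i 0 \is a Num.int) ->
  exists p : 'cV[int]_k, intvec p = v.
Proof.
move=> h; exists (\col_i Num.floor (v i 0)).
by apply/colP => i; rewrite !mxE floorK.
Qed.

End SupNorm.

Lemma cnorm_intvec_ge1 (R : realType) k (y : 'cV[int]_k) :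
  y != 0 -> 1 <= `|intvec y : 'cV[R]_k|.
Proof.
move=> y0; have [i yi] : exists i, y i 0 != 0.
  apply: contrapT => /forallNP h; move/eqP: y0; apply; apply/colP => i.
  by rewrite mxE; apply/eqP/negP => /negP; exact: h.
apply: le_trans (le_cnorm _ i); rewrite mxE -intr_norm ler1z.
by rewrite -gtz0_ge1 normr_gt0.
Qed.

Lemma dist_int_le (R : realType) k (v : 'cV[R]_k) (p : 'cV[int]_k) :
  dist_int v <= `|v - intvec p|.
Proof. by apply: ge_inf; [exists 0 => _ [q _ <-] | exists p]. Qed.

Lemma dist_int_ge0 (R : realType) k (v : 'cV[R]_k) : 0 <= dist_int v.
Proof.
apply: lb_le_inf; last by move=> _ [q _ <-].
by exists `|v - intvec 0|, 0.
Qed.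

Lemma root_exists (R : realType) k (t : R) : (0 < k)%N -> 0 < t ->
  exists2 x : R, 0 < x & x ^+ k = t.
Proof.
move=> k0 t0; exists (t `^ k%:R^-1); first exact: powR_gt0.
rewrite -powR_mulrn ?powR_ge0 // -powRrM mulVf ?powRr1 ?(ltW t0) //.
by rewrite pnatr_eq0 -lt0n.
Qed.

(** * Transference from homogeneous to inhomogeneous approximation *)

Lemma dot_row_mx (R : realType) n m (u : 'rV[R]_(n + m))
    (a : 'cV_n) (b : 'cV_m) :
  dot u (row_mx a^T b^T) = (lsubmx u *m a) 0 0 + (rsubmx u *m b) 0 0.
Proof.
by rewrite /dot -{1}(hsubmxK u) tr_row_mx !trmxK mul_row_col mxE.
Qed.

(** The hypothesis says that the lattice of the vectors
[(x / X, (Theta^T x - y) / Y)] has no short nonzero element. A short vector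
[(u, v)] inducing the character [(x, y) |-> eta^T x] then solves the
inhomogeneous problem: testing on the elements [(0, y)] shows that [v / Y] is
an integer vector [q], and testing on the elements [(x, 0)] shows that
[u / X + Theta q - eta] is an integer vector [p]. *)
Lemma inhomogeneous_transference (R : realType) n m (Theta : 'M[R]_(n, m))
    (X Y c : R) :
  0 < X -> 0 < Y -> 0 <= c -> 2 ^+ (n + m) - 1 <= 4 * c ^+ 2 ->
  (forall (x : 'cV[int]_n) (y : 'cV[int]_m), (x, y) != 0 ->
    X < `|intvec x : 'cV[R]_n| \/ Y < `|Theta^T *m intvec x - intvec y|) ->
  forall eta : 'cV[R]_n, exists (q : 'cV[int]_m) (p : 'cV[int]_n),
    `|Theta *m intvec q - eta - intvec p| <= c / X /\
    `|intvec q : 'cV[R]_m| <= c / Y.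
Proof.
move=> X0 Y0 c0 hc hD eta.
pose Z : zmodType := ('cV[int]_n * 'cV[int]_m)%type.
pose phi1 (z : Z) : 'cV[R]_n := X^-1 *: intvec z.1.
pose phi2 (z : Z) : 'cV[R]_m := Y^-1 *: (Theta^T *m intvec z.1 - intvec z.2).
pose phi (z : Z) : 'rV[R]_(n + m) := row_mx (phi1 z)^T (phi2 z)^T.
pose chi (z : Z) : R := (eta^T *m intvec z.1) 0 0.
have phi_ge1 z : z != 0 -> 1 <= dot (phi z) (phi z).
  have sq (t : R) : 1 < `|t| -> 1 <= t ^+ 2.
    by rewrite -(real_normK (num_real t)) => ?; rewrite exprn_ege1 // ltW.
  case: z => x y /hD [/(lt_cnorm (ltW X0))|/(lt_cnorm (ltW Y0))] [i hi].
  - apply: (le_trans _ (sqr_coord_le_dot _ (lshift m i))); apply: sq.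
    rewrite row_mxEl mxE [X in `|X|]mxE normrM gtr0_norm ?invr_gt0 //.
    by rewrite mulrC ltr_pdivlMr // mul1r.
  - apply: (le_trans _ (sqr_coord_le_dot _ (rshift n i))); apply: sq.
    rewrite row_mxEr mxE [X in `|X|]mxE normrM gtr0_norm ?invr_gt0 //.
    by rewrite mulrC ltr_pdivlMr // mul1r.
have [] := @small_character_rep R Z (n + m) (n + m) 1%:M phi chi 1.
- move=> z z'; rewrite /phi.
  have -> : phi1 (z - z') = phi1 z - phi1 z' by rewrite /phi1 intvecB scalerBr.
  have -> : phi2 (z - z') = phi2 z - phi2 z'.
    rewrite /phi2 !intvecB mulmxBr -scalerBr; congr (_ *: _).
    by rewrite opprD addrACA -opprD.
  by rewrite !linearB /= opp_row_mx add_row_mx.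
- by move=> z z'; rewrite /chi /= intvecB mulmxBr !mxE.
- by [].
- by rewrite rank_leq_row.
- by move=> z; exact: submx1.
- move=> z phiz; apply: phi_ge1; apply: contra phiz => /eqP ->.
  by rewrite /phi /phi1 /phi2 /= !intvec0 mulmx0 subrr !scaler0 !trmx0 row_mx0.
- move=> z phiz; have [->|/phi_ge1] := eqVneq z 0.
    by rewrite /chi /= intvec0 mulmx0 mxE int_num0.
  by rewrite phiz dot0l ler10.
move=> y [y_small yE].
pose u := lsubmx y; pose v := rsubmx y.
have yc i : `|y 0 i| <= c.
  rewrite -(ler_sqr (x := `|_|)) ?nnegrE // (real_normK (num_real _)).
  by have := sqr_coord_le_dot y i; lra.
have phiE z : dot y (phi z) = (u *m phi1 z) 0 0 + (v *m phi2 z) 0 0.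
  exact: dot_row_mx.
pose q0 : 'cV[R]_m := Y^-1 *: v^T.
have q0_int j : q0 j 0 \is a Num.int.
  have := yE (0, delta_mx j 0).
  rewrite phiE /phi1 /phi2 /chi /= intvec0 scaler0 !mulmx0 intvec_delta sub0r.
  rewrite scalerN mulmxN -scalemxAr -colE !mxE add0r subr0.
  by rewrite rpredN.
pose p0 : 'cV[R]_n := X^-1 *: u^T + Theta *m q0 - eta.
have p0_int i : p0 i 0 \is a Num.int.
  have := yE (delta_mx i 0, 0).
  rewrite phiE /phi1 /phi2 /chi /= intvec0 subr0 intvec_delta.
  rewrite -!scalemxAr mulmxA -!colE /p0 /q0.
  have -> : Theta *m (Y^-1 *: v^T) = Y^-1 *: (v *m Theta^T)^T.
    by rewrite trmx_mul trmxK scalemxAr.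
  by rewrite !mxE.
have [q qE] := intvec_of_int q0_int; have [p pE] := intvec_of_int p0_int.
have small w k (e : 'rV[R]_k) : 0 < w -> (forall i, `|e 0 i| <= c) ->
    `|w^-1 *: e^T| <= c / w.
  move=> w0 he; apply: cnorm_le => [|i]; first by rewrite divr_ge0 ?(ltW w0).
  by rewrite !mxE normrM gtr0_norm ?invr_gt0 // mulrC ler_pM2r ?invr_gt0 //.
exists q, p; split; last by rewrite qE; apply: small => // i; rewrite mxE.
have -> : Theta *m intvec q - eta - intvec p = - (X^-1 *: u^T).
  by rewrite qE pE /p0 -[_ + _ - eta]addrA opprD addrCA subrr addr0.
by rewrite normrN; apply: small => // i; rewrite mxE.
Qed.

(** The next lemmas compare the constant [kappa] with the constant
[sqrt (2^d - 1) / 2], [d = m + n], of the transference: the latter is less than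
half of [kappa]. *)
Lemma exp8_le_fact4 d : (1 < d)%N -> (8 ^ d <= 4 * d`! ^ 4)%N.
Proof.
case: d => [//|[//|d]] _; elim: d => // d IH.
rewrite expnS factS expnMn mulnCA leq_mul // (leq_trans (n := (3 ^ 4))) //.
by rewrite leq_exp2r.
Qed.

Lemma kappaE (R : realType) m n :
  kappa R m n = 2 * (m + n)`!%:R ^+ 2 / 2 ^+ (m + n).
Proof.
rewrite /kappa -addrA -opprD -PoszD expfzDr ?pnatr_eq0 // expr1z -exprnN.
by rewrite mulrAC.
Qed.

Lemma kappa_gt0 (R : realType) m n : 0 < kappa R m n.
Proof.
by rewrite kappaE divr_gt0 ?mulr_gt0 ?exprn_gt0 ?ltr0n ?fact_gt0.
Qed.

Lemma exp2_le_kappa2 (R : realType) m n : (0 < m)%N -> (0 < n)%N ->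
  2 ^+ (m + n) <= kappa R m n ^+ 2.
Proof.
move=> m0 n0; rewrite kappaE expr_div_n ler_pdivlMr ?exprn_gt0 //.
have d2 : (1 < m + n)%N by rewrite (leq_add m0 n0).
have -> : 2 ^+ (m + n) * (2 ^+ (m + n)) ^+ 2 = (8 ^ (m + n))%:R :> R.
  by rewrite -exprS exprAC natrX; congr (_ ^+ _); rewrite -natrX.
have -> : (2 * (m + n)`!%:R ^+ 2) ^+ 2 = (4 * (m + n)`! ^ 4)%:R :> R.
  by rewrite natrM natrX; ring.
by rewrite ler_nat exp8_le_fact4.
Qed.

(** Because the transference constant [c] is less than [kappa / 2], there is
room to translate the target by [Theta q0] with an integer vector [q0] a little
longer than [c / Y + M]. The solution is then shifted to one whose norm exceeds
any prescribed [M], still within [kappa / Y] once [Y] is small. *)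
Lemma transference_large (R : realType) n m (Theta : 'M[R]_(n, m)) (M : R) :
  (0 < m)%N -> (0 < n)%N -> 0 <= M ->
  exists2 e : R, 0 < e & forall X Y : R, 0 < X -> 0 < Y -> Y <= e ->
  (forall (x : 'cV[int]_n) (y : 'cV[int]_m), (x, y) != 0 ->
    X < `|intvec x : 'cV[R]_n| \/ Y < `|Theta^T *m intvec x - intvec y|) ->
  forall eta : 'cV[R]_n, exists (q : 'cV[int]_m) (p : 'cV[int]_n),
    [/\ `|Theta *m intvec q - eta - intvec p| <= kappa R m n / X,
    M < `|intvec q : 'cV[R]_m| & `|intvec q : 'cV[R]_m| <= kappa R m n / Y].
Proof.
move=> m0 n0 M0; set K := kappa R m n; have K0 : 0 < K := kappa_gt0 R m n.
pose c := Num.sqrt (2 ^+ (n + m) - 1 : R) / 2.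
have c0 : 0 <= c by rewrite divr_ge0 ?sqrtr_ge0.
have c2 : 4 * c ^+ 2 = 2 ^+ (n + m) - 1.
  rewrite expr_div_n sqr_sqrtr ?subr_ge0 ?exprn_ege1 ?ler1n //.
  by field.
have c2le : 2 ^+ (n + m) - 1 <= 4 * c ^+ 2 by rewrite c2.
have cK : 2 * c < K.
  rewrite -ltr_sqr ?nnegrE ?mulr_ge0 ?(ltW K0) //.
  have := exp2_le_kappa2 R m0 n0; rewrite -/K addnC; lra.
exists ((K - 2 * c) / (M + 1)).
  by rewrite divr_gt0 //; lra.
move=> X Y X0 Y0 Ye hD eta.
have M1 : 0 < M + 1 by lra.
have hM : M + 1 <= (K - 2 * c) / Y.
  by rewrite ler_pdivlMr // mulrC -ler_pdivlMr.
have cY : 0 <= c / Y by rewrite divr_ge0 // ltW.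
pose N0 := (Num.trunc (c / Y + M)).+1.
have /andP[N1 N2] : (N0.-1)%:R <= c / Y + M < N0%:R.
  by apply: truncn_itv; rewrite addr_ge0.
pose q0 : 'cV[int]_m := const_mx (Posz N0).
have q0E : `|intvec q0 : 'cV[R]_m| = N0%:R.
  apply/eqP; rewrite eq_le; apply/andP; split.
    by apply: cnorm_le => // i; rewrite !mxE ger0_norm.
  by apply: le_trans (le_cnorm _ (Ordinal m0)); rewrite !mxE ger0_norm.
have [q [p [hp hq]]] :=
  inhomogeneous_transference X0 Y0 c0 c2le hD (eta - Theta *m intvec q0).
exists (q + q0), p; split.
- apply: le_trans (_ : c / X <= _); last by rewrite ler_pM2r ?invr_gt0 //; lra.
  by move: hp; rewrite intvecD mulmxDr opprB addrA.
- have : N0%:R <= `|intvec (q + q0) : 'cV[R]_m| + `|intvec q : 'cV[R]_m|.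
    rewrite -q0E intvecD; apply: le_trans (ler_normB _ _).
    by rewrite addrC addKr.
  by lra.
- rewrite intvecD (le_trans (ler_normD _ _)) // q0E.
  move: hM hq N1 N2; rewrite mulrBl -[2 * c / Y]mulrA /N0 /= -natr1; lra.
Qed.

(** * Lebesgue null sets *)

Section Null.
Variables (R : realType) (n : nat).
Implicit Types (A E : set 'cV[R]_n) (b c x : 'cV[R]_n) (l : seq 'cV[R]_n).

Lemma volume_ge0 (a b : 'cV[R]_n) : (forall i, a i 0 <= b i 0) ->
  (0 <= (\prod_i (b i 0 - a i 0))%:E)%E.
Proof. by move=> h; rewrite lee_fin prodr_ge0 // => i _; rewrite subr_ge0. Qed.

Lemma lebesgue_null_small A :
  (forall e : R, 0 < e -> (lebesgue_outer A <= e%:E)%E) -> lebesgue_null A.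
Proof.
move=> h; apply/eqP; rewrite eq_le; apply/andP; split.
  by apply/lee_addgt0Pr => e e0; rewrite add0e; exact: h.
apply: le_ereal_inf_tmp => _ [a [b [ab _ ->]]].
by apply: nneseries_ge0 => k _ _; exact: volume_ge0.
Qed.

(** Covers of the [k]-th set of total volume [e / 2^(k+1)] are merged into one
sequence through a bijection between [nat] and [nat * nat]. *)
Lemma lebesgue_null_bigcup A (A_ : nat -> set 'cV[R]_n) :
  (forall k, lebesgue_null (A_ k)) -> A `<=` \bigcup_k A_ k -> lebesgue_null A.
Proof.
move=> A0 AA; apply: lebesgue_null_small => e e0.
pose P k (G : (nat -> 'cV[R]_n) * (nat -> 'cV[R]_n)) :=
  [/\ forall j i, G.1 j i 0 <= G.2 j i 0,
      A_ k `<=` \bigcup_j box (G.1 j) (G.2 j) &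
      (\sum_(0 <= j <oo) (\prod_i (G.2 j i 0 - G.1 j i 0))%:E <=
       (e / (2 ^ k.+1)%:R)%:E)%E].
have [G PG] : {G & forall k, P k (G k)}.
  apply: (@choice _ _ P) => k.
  have : (lebesgue_outer (A_ k) < (e / (2 ^ k.+1)%:R)%:E)%E.
    by rewrite A0 lte_fin divr_gt0 // ltr0n expn_gt0.
  by move=> /ereal_inf_lt[_ [a [b [ab cov ->]]] /ltW small]; exists (a, b).
have /card_esym/ppcard_eqP[f] := card_nat2.
pose a (p : nat * nat) := (G p.1).1 p.2.
pose b (p : nat * nat) := (G p.1).2 p.2.
pose vol (p : nat * nat) := ((\prod_i (b p i 0 - a p i 0))%:E : \bar R).
have vol0 p : (0 <= vol p)%E.
  by apply: volume_ge0 => i; case: (PG p.1) => ab _ _; exact: ab.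
apply: (@le_trans _ _ (\esum_(p in setT) vol p)).
  apply: ereal_inf_lbound; exists (a \o f), (b \o f); split=> [k i|x Ax|].
  - by case: (PG (f k).1) => ab _ _; exact: ab.
  - have [i _ Aix] := AA _ Ax; have [_ /(_ _ Aix)[j _ xj] _] := PG i.
    by exists (f^-1%FUN (i, j)) => //=; rewrite /a /b invK ?inE.
  - rewrite -[RHS](esum_pred_image vol f xpredT)//;
      last by move=> i j _ _; apply: (@inj _ _ _ f); rewrite inE.
    congr (esum _ _); apply/seteqP; split=> // p _.
    by exists (f^-1%FUN p) => //; rewrite invK ?inE.
pose J : nat -> set (nat * nat) := fun i => [set (i, j) | j in setT].
have -> : setT = \bigcup_k J k.
  by rewrite predeqE => -[i j]; split => // _; exists i => //; exists j.
rewrite esum_bigcupT //; last first.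
  apply/trivIsetP => i j _ _ ij.
  rewrite predeqE => -[k l] /=; split => //= -[] [_] _ [<-{k} _].
  by move=> [l' _] [] /esym/eqP; rewrite (negbTE ij).
rewrite -nneseries_esumT; last by move=> i; exact: esum_ge0.
apply: le_trans (epsilon_trick0 xpredT (ltW e0)).
apply: lee_nneseries => [i _ _|i _]; first exact: esum_ge0.
have -> : J i = pair i @` setT by [].
rewrite esum_image //; last by move=> j k _ _ [].
rewrite -nneseries_esumT //.
by case: (PG i).
Qed.

Definition cube b (s : R) : set 'cV[R]_n := box b (b + const_mx s).

Definition cubes l (s : R) : set 'cV[R]_n :=
  [set x | exists2 b, b \in l & cube b s x].

Lemma cubeP b (s : R) x : cube b s x <-> forall i, b i 0 <= x i 0 <= b i 0 + s.
Proof. by split=> h i; move: (h i); rewrite !mxE. Qed.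

Lemma lebesgue_null_cubes E : (0 < n)%N ->
  (forall e : R, 0 < e -> exists l s, [/\ 0 <= s, E `<=` cubes l s &
    (size l)%:R * s ^+ n <= e]) -> lebesgue_null E.
Proof.
move=> n0 h; apply: lebesgue_null_small => e e0.
have [l [s [s0 El small]]] := h e e0.
pose a k := nth 0 l k.
(* The finite list is continued by degenerate boxes, of volume 0 as [0 < n]. *)
pose b k := if (k < size l)%N then a k + const_mx s else a k.
have vol k : \prod_i (b k i 0 - a k i 0) = if (k < size l)%N then s ^+ n else 0.
  rewrite /b; case: ifP => _; last first.
    by rewrite (bigD1 (Ordinal n0)) //= subrr mul0r.
  rewrite (eq_bigr (fun=> s)); last by move=> i _; rewrite !mxE addrC addKr.
  by rewrite prodr_const card_ord.
have vol0 k : (0 <= (\prod_i (b k i 0 - a k i 0))%:E)%E.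
  by rewrite lee_fin vol; case: ifP => // _; rewrite exprn_ge0.
apply: (@le_trans _ _ (\sum_(0 <= k <oo) (\prod_i (b k i 0 - a k i 0))%:E)%E).
  apply: ereal_inf_lbound; exists a, b; split=> // [k i|x /El[c cl xc]].
    by rewrite /b; case: ifP => _ //; rewrite !mxE lerDl.
  exists (index c l) => //.
  by rewrite /b index_mem cl /a nth_index.
rewrite (nneseries_split 0 (size l)) // add0n [X in (_ + X)%E]eseries0 ?adde0.
  rewrite sumEFin lee_fin; apply: le_trans small; rewrite big_mkord.
  rewrite (eq_bigr (fun=> s ^+ n)); last by move=> i _; rewrite vol ltn_ord.
  by rewrite sumr_const card_ord mulr_natl.
by move=> k lk _; rewrite vol ltnNge lk.
Qed.

Lemma refine_cubes E l (s s' : R) K : E `<=` cubes l s ->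
  (forall b, exists2 l', (size l' <= K)%N & E `&` cube b s `<=` cubes l' s') ->
  exists2 l', (size l' <= size l * K)%N & E `<=` cubes l' s'.
Proof.
move=> El h.
have [F hF] : {F & forall b, (size (F b) <= K)%N /\
    E `&` cube b s `<=` cubes (F b) s'}.
  by apply: (@choice _ _ (fun b l' => (size l' <= K)%N /\
    E `&` cube b s `<=` cubes l' s')) => b; have [l' ? ?] := h b; exists l'.
exists (flatten (map F l)).
  rewrite size_flatten; elim: l {El} => //= c l IH; rewrite mulSn leq_add //.
  by case: (hF c).
move=> x Ex; have [c cl xc] := El _ Ex.
have [c' c'F xc'] := (hF c).2 _ (conj Ex xc).
by exists c' => //; apply/flatten_mapP; exists c.
Qed.

Lemma cube_split b (s : R) N : (0 < N)%N -> 0 < s ->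
  exists2 l, size l = (N ^ n)%N & cube b s `<=` cubes l (s / N%:R).
Proof.
case: N => // N _ s0; pose h : R := s / N.+1%:R.
have N0R : (0 : R) < N.+1%:R by rewrite ltr0n.
have h0 : 0 < h by rewrite divr_gt0.
exists [seq b + h *: (\col_i (v i : nat)%:R) | v : {ffun 'I_n -> 'I_N.+1}].
  by rewrite size_map -cardE card_ffun !card_ord.
move=> x /cubeP xb.
(* The minimum with [N] puts the points of the upper faces in the last cubes. *)
pose v :=
  [ffun i => inord (minn N (Num.trunc ((x i 0 - b i 0) / h))) : 'I_N.+1].
exists (b + h *: (\col_i (v i : nat)%:R));
  first by apply/mapP; exists v; rewrite ?mem_enum.
apply/cubeP => i; rewrite -/h !mxE ffunE inordK ?ltnS ?geq_minl //.
have /andP[x1 x2] := xb i.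
set t := (x i 0 - b i 0) / h.
have xE : x i 0 = b i 0 + h * t.
  by rewrite /t mulrC divfK ?gt_eqF // addrC subrK.
have t0 : 0 <= t by rewrite divr_ge0 ?(ltW h0) // subr_ge0.
have tN : t <= N.+1%:R.
  by rewrite ler_pdivrMr // [_ * h]mulrC /h divfK ?gt_eqF //; lra.
have /andP[t1 t2] := truncn_itv t0.
rewrite xE -addrA !lerD2l -[X in _ <= _ + X]mulr1 -mulrDr !ler_pM2l //.
case: (leqP N (Num.trunc t)) => Nt.
  by rewrite natr1 tN andbT (le_trans _ t1) // ler_nat.
by rewrite t1 natr1 ltW.
Qed.

(** * Porous sets are null *)

(** Porosity is required only at some scales tending to 0, but there uniformly
in the position: the Dirichlet property may hold at all the other scales. *)
Definition porous E := exists2 e : R, 0 < e & forall r0 : R, 0 < r0 ->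
  exists r, [/\ 0 < r, r < r0 & forall t, exists2 c, `|c - t| <= r &
    forall x, `|x - c| < e * r -> ~ E x].

(** A cube of side about [r] contains the centre of a hole, and the subcube
around this centre lies inside the hole once [M] is large, so this subcube can
be discarded. *)
Lemma porous_refine E M e r h b : (0 < M)%N -> 4 < e * M%:R -> 0 < r ->
  2 * r <= h -> h <= 4 * r ->
  (forall t, exists2 c, `|c - t| <= r & forall x, `|x - c| < e * r -> ~ E x) ->
  exists2 l, (size l <= (M ^ n).-1)%N & E `&` cube b h `<=` cubes l (h / M%:R).
Proof.
move=> M0 eM r0 h1 h2 /(_ (b + const_mx (h / 2)))[c ct cE].
have h0 : 0 < h by lra.
have MR : (0 : R) < M%:R by rewrite ltr0n.
have [l lM bl] := cube_split b M0 h0.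
have /bl[c' c'l /cubeP cc'] : cube b h c.
  apply/cubeP => i; have := le_trans (le_cnorm _ i) ct.
  by rewrite !mxE ler_norml => /andP[]; lra.
exists (rem c' l); first by rewrite size_rem // lM.
move=> x [Ex /bl[c'' c''l xc'']]; exists c'' => //.
have := perm_mem (perm_to_rem c'l) c''.
rewrite c''l inE => /esym/orP[/eqP E1|//].
case: (cE x) => //; move: xc''; rewrite E1 => /cubeP xc.
have hM : h / M%:R < e * r.
  by rewrite ltr_pdivrMr // mulrAC (le_lt_trans h2) // ltr_pM2r.
apply: le_lt_trans hM; apply: cnorm_le => [|i].
  by rewrite divr_ge0 // ltW.
have := xc i; have := cc' i; rewrite !mxE ler_norml.
by move=> /andP[? ?] /andP[? ?]; apply/andP; split; lra.
Qed.

(** Cutting first to the scale of the holes, where nothing is gained, and then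
into [M ^ n] pieces of which one is discarded, multiplies the total volume by
[(M ^ n - 1) / M ^ n], a ratio independent of the starting cover. *)
Lemma porous_shrink E : porous E -> exists2 theta : R, 0 <= theta < 1 &
  forall l s, 0 < s -> exists l' s', [/\ 0 < s',
    E `&` cubes l s `<=` cubes l' s' &
    (size l')%:R * s' ^+ n <= theta * ((size l)%:R * s ^+ n)].
Proof.
move=> [e e0 porE].
pose M := (Num.trunc (4 / e)).+1.
have eM : 4 < e * M%:R.
  have /andP[_] : (M.-1)%:R <= 4 / e < M%:R.
    by apply: truncn_itv; rewrite divr_ge0 // ltW.
  by rewrite ltr_pdivrMr // mulrC.
have MR : (0 : R) < M%:R by rewrite ltr0n.
have Mn : (0 < M ^ n)%N by rewrite expn_gt0.
exists ((M ^ n).-1%:R / (M ^ n)%:R).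
  rewrite divr_ge0 //= ltr_pdivrMr ?ltr0n // mul1r ltr_nat.
  by rewrite ltn_predL.
move=> l s s0.
have s20 : 0 < s / 2 by rewrite divr_gt0.
have [r [r0 rs hole]] := porE _ s20.
pose N := Num.trunc (s / (2 * r)).
have r20 : 0 < 2 * r by lra.
have t1 : 1 <= s / (2 * r) by rewrite ler_pdivlMr //; lra.
have /andP[N1 N2] : N%:R <= s / (2 * r) < N.+1%:R.
  by apply: truncn_itv; lra.
have N0 : (0 < N)%N by rewrite -ltnS -(ltr_nat R) (le_lt_trans t1).
have NR : (0 : R) < N%:R by rewrite ltr0n.
have N1R : (1 : R) <= N%:R by rewrite ler1n.
move: N1 N2; rewrite ler_pdivlMr // ltr_pdivrMr // -[N.+1%:R]natr1 => N1 N2.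
pose h := s / N%:R.
have h1 : 2 * r <= h by rewrite ler_pdivlMr // mulrC.
have h2 : h <= 4 * r.
  by rewrite ler_pdivrMr //; nra.
have [|l1 l1s l1E] := @refine_cubes (cubes l s) l s h (N ^ n) (fun x => id).
  move=> b; have [l' l'N bl'] := cube_split b N0 s0.
  by exists l'; [rewrite l'N | move=> x [_ /bl']].
have [||l2 l2s l2E] :=
    @refine_cubes (E `&` cubes l s) l1 h (h / M%:R) (M ^ n).-1.
- by move=> x [_ /l1E].
- move=> b; have [l' l'M bl'] := porous_refine b (ltn0Sn _) eM r0 h1 h2 hole.
  by exists l' => // x [[Ex _] xb]; apply: bl'.
exists l2, (h / M%:R); split=> //; first by rewrite !divr_gt0.
have sE : s = h / M%:R * (N%:R * M%:R).
  by rewrite /h; field; rewrite !gt_eqF.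
rewrite [in leRHS]sE; set s' := h / _ in sE *.
have s'0 : 0 <= s' ^+ n by rewrite exprn_ge0 // !divr_ge0 ?ltW.
rewrite (exprMn n s') (exprMn n N%:R) -!natrX.
have -> : (M ^ n).-1%:R / (M ^ n)%:R * ((size l)%:R *
   (s' ^+ n * ((N ^ n)%:R * (M ^ n)%:R))) =
   (size l * N ^ n * (M ^ n).-1)%:R * s' ^+ n :> R.
  by rewrite !natrM; field; rewrite pnatr_eq0 -lt0n.
rewrite ler_wpM2r // ler_nat (leq_trans l2s) // leq_mul2r l1s orbT //.
Qed.

Lemma porous_null E : (0 < n)%N -> porous E -> lebesgue_null E.
Proof.
move=> n0 /porous_shrink[theta /andP[th0 th1] shrink].
pose A k := E `&` cube (- const_mx k%:R) (2 * k%:R + 1).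
apply: (@lebesgue_null_bigcup _ A) => [k|x Ex]; last first.
  pose k := (Num.trunc `|x|).+1.
  have /andP[_ xk] : (k.-1)%:R <= `|x| < k%:R by apply: truncn_itv.
  exists k => //; split=> //; apply/cubeP => i; rewrite !mxE.
  have := le_trans (le_cnorm x i) (ltW xk); rewrite ler_norml => /andP[? ?].
  by apply/andP; split; lra.
set S : R := 2 * k%:R + 1.
have S0 : 0 < S by have := ler0n R k; rewrite /S; lra.
have iter j : exists l s, [/\ 0 < s, A k `<=` cubes l s &
    (size l)%:R * s ^+ n <= theta ^+ j * S ^+ n].
  elim: j => [|j [l [s [s0 Al small]]]].
    exists [:: - const_mx k%:R], S; split=> //.
    by move=> x [_ xS]; exists (- const_mx k%:R) => //; rewrite inE.
  have [l' [s' [s'0 Al' small']]] := shrink l s s0.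
  exists l', s'; split=> // [x Ax|].
    by apply: Al'; split; [case: Ax | exact: Al].
  by apply: le_trans small' _; rewrite exprS -mulrA ler_wpM2l.
apply: lebesgue_null_cubes => // e e0.
have Sn0 : 0 < S ^+ n by rewrite exprn_gt0.
have : theta ^+ j @[j --> \oo] --> (0 : R).
  by apply: cvg_expr; rewrite ger0_norm.
move=> /cvgrPdist_lt /(_ (e / S ^+ n)).
rewrite divr_gt0 // => /(_ isT) [j _ /(_ j (leqnn j))] /=.
rewrite sub0r normrN ger0_norm ?exprn_ge0 // ltr_pdivlMr // => small.
have [l [s [s0 Al hl]]] := iter j; exists l, s; split=> //; first exact: ltW.
by rewrite (le_trans hl) // ltW.
Qed.
End Null.

(** * Inhomogeneous coverings from the failure of the Dirichlet property *)

Lemma not_Dirichlet_scale (R : realType) a b (F : R -> R) (Phi : 'M[R]_(a, b)) :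
  F T @[T --> +oo] --> 0 -> ~ Dirichlet F Phi ->
  forall T0 e : R, 0 < e -> exists T, [/\ T0 < T, F T < e &
    forall x : 'cV[int]_b, x != 0 -> dist_int (Phi *m intvec x) ^+ a <= F T ->
      T < `|intvec x : 'cV[R]_b| ^+ b].
Proof.
move=> F0 nD T0 e e0; apply: contrapT => h; apply: nD.
have Fe : \forall T \near +oo, F T < e.
  have /cvgrPdist_lt /(_ _ e0) := F0; apply: filterS => T.
  by rewrite sub0r normrN; apply: le_lt_trans; exact: ler_norm.
rewrite /Dirichlet; near=> T.
apply: contrapT => hT; apply: h; exists T; split.
- by near: T; apply: nbhs_pinfty_gt; exact: num_real.
- by near: T.
- by move=> x x0 xF; rewrite ltNge; apply/negP => xT; apply: hT; exists x.
Unshelve. all: by end_near. Qed.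

(** At a scale [T] where no nonzero [x] satisfies the Dirichlet condition, the
homogeneous system has no solution with [X = T^(1/n)] and [Y = f(T)^(1/m)]. The
case [x = 0] needs [Y < 1]. *)
Lemma not_Dirichlet_covering (R : realType) n m (Theta : 'M[R]_(n, m))
    (f : R -> R) (M S0 : R) :
  (0 < m)%N -> (0 < n)%N -> (forall T, 0 < T -> 0 < f T) ->
  f T @[T --> +oo] --> 0 -> ~ Dirichlet f Theta^T -> 0 <= M ->
  exists T X : R, [/\ 0 < T, 0 < X, X ^+ n = T, S0 < X & forall eta,
    exists (q : 'cV[int]_m) (p : 'cV[int]_n),
    [/\ `|Theta *m intvec q - eta - intvec p| <= kappa R m n / X,
    M < `|intvec q : 'cV[R]_m| &
    `|intvec q : 'cV[R]_m| ^+ m * f T <= kappa R m n ^+ m]].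
Proof.
move=> m0 n0 f_gt0 f0 nD M0.
have [e e0 transf] := transference_large Theta m0 n0 M0.
pose d := Num.min e 1.
have d0 : 0 < d by rewrite /d lt_min e0 /=.
have [T [T1 fTd noT]] :=
  not_Dirichlet_scale f0 nD (`|S0| ^+ n) (exprn_gt0 m d0).
have T0 : 0 < T by apply: le_lt_trans T1; rewrite exprn_ge0.
have [X X0 XT] := root_exists n0 T0.
have [Y Y0 YT] := root_exists m0 (f_gt0 _ T0).
have Yd : Y < d.
  by rewrite -(ltr_pXn2r m0) ?nnegrE ?(ltW Y0) ?(ltW d0) // YT.
exists T, X; split=> //.
  apply: le_lt_trans (ler_norm _) _.
  by rewrite -(ltr_pXn2r n0) ?nnegrE ?(ltW X0) // XT.
move=> eta.
have [||q [p [qp Mq qY]]] := transf X Y X0 Y0 _ _ eta.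
- by rewrite (le_trans (ltW Yd)) // ge_min lexx.
- move=> x y xy; have [x0|x0] := eqVneq x 0.
    right; have y0 : y != 0 by apply: contra xy; rewrite x0 => /eqP ->.
    rewrite x0 intvec0 mulmx0 sub0r normrN (lt_le_trans Yd) //.
    by rewrite ge_min (cnorm_intvec_ge1 R y0) orbT.
  have [distY|Ydist] := leP (dist_int (Theta^T *m intvec x)) Y.
    left; rewrite -(ltr_pXn2r n0) ?nnegrE ?(ltW X0) // XT noT //.
    by rewrite -YT lerXn2r ?nnegrE ?dist_int_ge0 // ltW.
  by right; apply: lt_le_trans Ydist _; exact: dist_int_le.
exists q, p; split=> //.
have K0 := kappa_gt0 R m n.
rewrite -YT -exprMn lerXn2r ?nnegrE ?mulr_ge0 ?(ltW Y0) ?(ltW K0) //.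
by rewrite -ler_pdivlMr.
Qed.

(** * Badly approximable targets form a null set *)

(** The targets kept away from all the solutions that the coverings provide; the
positive lower bound and the range of [q] are both governed by [k], to make
this a countable family. *)
Definition repelled (R : realType) n m (Theta : 'M[R]_(n, m)) (f : R -> R)
    (k : nat) : set 'cV[R]_n :=
  [set eta | forall (q : 'cV[int]_m) T, k%:R < `|intvec q : 'cV[R]_m| ->
    0 < T -> `|intvec q : 'cV[R]_m| ^+ m * f T <= kappa R m n ^+ m ->
    k.+1%:R^-1 <= T * dist_int (Theta *m intvec q - eta) ^+ n].

(** The points [Theta q - p] of the coverings are the centres of the holes:
every target is within [kappa / X] of one of them, and a point that is closer
to it than [1 / ((k + 1) X)] violates the defining inequality at [T = X^n]. *)
Lemma repelled_porous (R : realType) n m (Theta : 'M[R]_(n, m)) (f : R -> R) k :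
  (0 < m)%N -> (0 < n)%N -> (forall T, 0 < T -> 0 < f T) ->
  f T @[T --> +oo] --> 0 -> ~ Dirichlet f Theta^T ->
  porous (repelled Theta f k).
Proof.
move=> m0 n0 f_gt0 f0 nD; set K := kappa R m n.
have K0 : 0 < K := kappa_gt0 R m n.
have k0 : (0 : R) < k.+1%:R by rewrite ltr0n.
exists (k.+1%:R^-1 / K); first by rewrite divr_gt0 // invr_gt0.
move=> r0 r0_gt0.
have [T [X [T0 X0 XT KX covers]]] :=
  not_Dirichlet_covering (K / r0) m0 n0 f_gt0 f0 nD (ler0n R k).
have r_gt0 : 0 < K / X by rewrite divr_gt0.
exists (K / X); split=> //.
  by rewrite ltr_pdivrMr // mulrC -ltr_pdivrMr.
move=> t; have [q [p [qp kq qT]]] := covers t.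
exists (Theta *m intvec q - intvec p); first by rewrite addrAC.
move=> x; have -> : k.+1%:R^-1 / K * (K / X) = k.+1%:R^-1 / X.
  by field; rewrite !gt_eqF.
move=> xc /(_ q T kq T0 qT); apply/negP; rewrite -ltNge.
have distX : X * dist_int (Theta *m intvec q - x) < k.+1%:R^-1.
  rewrite mulrC -ltr_pdivlMr //; apply: le_lt_trans xc.
  by rewrite distrC addrAC; exact: dist_int_le.
have distX0 : 0 <= X * dist_int (Theta *m intvec q - x).
  by rewrite mulr_ge0 ?dist_int_ge0 // ltW.
rewrite -XT -exprMn.
apply: (@lt_le_trans _ _ (k.+1%:R^-1 ^+ n)).
  by rewrite ltr_pXn2r ?nnegrE // invr_ge0 ltW.
by rewrite ler_iXnr // ?invr_ge0 ?(ltW k0) // invf_le1 // ler1n.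
Qed.

Lemma BAhat_bound (R : realType) n m (Theta : 'M[R]_(n, m)) (h : R -> R) eta :
  BAhat Theta h eta -> exists2 delta : R, 0 < delta &
    exists M, forall q : 'cV[int]_m, M < `|intvec q : 'cV[R]_m| ->
      delta <= dist_int (Theta *m intvec q - eta) ^+ n
               / h (`|intvec q : 'cV[R]_m| ^+ m).
Proof.
rewrite /BAhat /= limf_einfE => /ereal_sup_gt[_ [V [M _ MV] <-]].
set I := ereal_inf _ => I0.
have Ile q : M < `|intvec q : 'cV[R]_m| ->
    (I <= (dist_int (Theta *m intvec q - eta) ^+ n
           / h (`|intvec q : 'cV[R]_m| ^+ m))%:E)%E.
  by move=> Mq; apply: ereal_inf_lbound; exists q => //; exact: MV.
case: I I0 Ile => [d| |] //.
  by rewrite lte_fin => d0 h'; exists d => //; exists M => q /h'.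
(* An infinite infimum bounds the ratio below by any constant. *)
by move=> _ h'; exists 1 => //; exists M => q /h'.
Qed.

(** With [S = |q|^m], the inequality [S f(T) <= kappa^m] is the bound on [q] in
the covering at the scale [T]. There the condition on [h] turns a lower bound
for the ratio in [BAhat] into one for [T] times the numerator. *)
Lemma BAhat_null (R : realType) n m (Theta : 'M[R]_(n, m)) (f h : R -> R)
    (C S0 : R) :
  (0 < m)%N -> (0 < n)%N -> (forall T, 0 < T -> 0 < f T) ->
  f T @[T --> +oo] --> 0 -> ~ Dirichlet f Theta^T -> 0 < C ->
  (forall S T, S0 < S -> 0 < T -> S * f T <= kappa R m n ^+ m ->
     (h S)^-1 <= C * T) ->
  lebesgue_null (BAhat Theta h).
Proof.
move=> m0 n0 f_gt0 f0 nD C0 hC.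
apply: (@lebesgue_null_bigcup _ _ _ (repelled Theta f)) => [k|eta].
  by apply: porous_null => //; exact: repelled_porous.
move=> /BAhat_bound[d d0 [M dM]].
pose b := `|M| + `|S0| + C / d + 1.
have Cd : 0 < C / d by rewrite divr_gt0.
have b0 : 0 <= b by rewrite /b !addr_ge0 // ltW.
exists (Num.trunc b).+1 => // q T.
set k := (Num.trunc b).+1; have /andP[_ bk] := truncn_itv b0.
rewrite -/k in bk; set Q := `|intvec q : 'cV[R]_m| => kQ T0 QT.
have [M0 S00] := (normr_ge0 M, normr_ge0 S0).
have [MM SS] := (ler_norm M, ler_norm S0).
have Qm : Q <= Q ^+ m by rewrite ler_eXnr //; rewrite /b in bk; lra.
have dle : d <= dist_int (Theta *m intvec q - eta) ^+ n * (C * T).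
  apply: le_trans (dM q _) _; first by rewrite -/Q; rewrite /b in bk; lra.
  rewrite ler_wpM2l ?exprn_ge0 ?dist_int_ge0 // hC //.
  by rewrite -/Q; rewrite /b in bk; lra.
apply: (@le_trans _ _ (d / C)).
  rewrite -[d / C]invrK lef_pV2 ?posrE ?invr_gt0 ?divr_gt0 ?ltr0n // invf_div.
  by rewrite -natr1; rewrite /b in bk; lra.
by rewrite ler_pdivrMr // -mulrA mulrC -mulrA.
Qed.

Lemma range_of_cvg0 (R : realType) (f : R -> R) u :
  {within [set T | 0 < T], continuous f} ->
  f T @[T --> +oo] --> 0 -> 0 < u -> u < f 1 -> exists2 T, 0 < T & f T = u.
Proof.
move=> f_cont f0 u0 uf.
have : \forall T \near +oo, f T < u /\ 1 < T.
  near=> T; split; last first.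
    by near: T; apply: nbhs_pinfty_gt; exact: num_real.
  rewrite -[f T]subr0; apply: le_lt_trans (ler_norm _) _; rewrite distrC.
  by near: T; move/cvgrPdist_lt : f0; exact.
move=> [T1 [_ /(_ (T1 + 1))]]; rewrite ltrDl => /(_ ltr01).
set T2 := T1 + 1 => -[fT2 T2_gt1].
have [|||T] := @IVT R f 1 T2 u.
- exact: ltW.
- apply: continuous_subspaceW f_cont => x /=.
  by rewrite in_itv /= => /andP[x1 _]; exact: lt_le_trans x1.
- by rewrite ge_min le_max (ltW fT2) (ltW uf) orbT.
rewrite in_itv /= => /andP[T_ge1 _] <-; exists T => //.
exact: lt_le_trans T_ge1.
Unshelve. all: by end_near. Qed.

Theorem theorem3p3 (R : realType) (m n : nat) (m_gt0 : (0 < m)%N)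
    (n_gt0 : (0 < n)%N) (f finv : R -> R)
    (f_gt0 : forall T, 0 < T -> 0 < f T)
    (f_continuous : {within [set T | 0 < T], continuous f})
    (f_decreasing : forall S T, 0 < S -> S < T -> f T < f S)
    (f_inverse : forall T, 0 < T -> finv (f T) = T)
    (f_cvg0 : f T @[T --> +oo] --> 0)
    (Theta : 'M[R]_(n, m))
    (Theta_notD : ~ Dirichlet f Theta^T) :
  lebesgue_null
    (BAhat Theta (fun T => dual_rate finv (T / kappa R m n ^+ m))) /\
  ((exists2 gamma : R, 0 < gamma &
      \forall C \near +oo, forall T, 0 < T ->
        f (C * T) <= C `^ (- gamma) * f T) ->
   lebesgue_null (BAhat Theta (dual_rate finv))).
Proof.
set K := kappa R m n ^+ m.
have K0 : 0 < K by rewrite exprn_gt0 // kappa_gt0.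
have f1 : 0 < f 1 by exact: f_gt0.
have le_of_f S T : 0 < S -> 0 < T -> f T <= f S -> S <= T.
  by move=> S0 T0; apply: contraTT; rewrite -!ltNge => /(f_decreasing _ _ T0).
have preimage u S : 0 < u -> `|u / f 1| < S ->
    [/\ 0 < S, 0 < finv (u / S) & f (finv (u / S)) = u / S].
  move=> u0 uS; have S0 : 0 < S by apply: le_lt_trans uS.
  have [||T T0 fT] :=
      range_of_cvg0 f_continuous f_cvg0 (u := u / S).
  - exact: divr_gt0.
  - rewrite ltr_pdivrMr // mulrC -ltr_pdivrMr //.
    by rewrite (le_lt_trans _ uS) ?ler_norm.
  by rewrite -fT f_inverse.
split.
  apply: (@BAhat_null _ _ _ Theta f _ 1 `|K / f 1|) => // S T KS T0 ST.
  have [S0 finv0 fE] := preimage _ _ K0 KS.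
  rewrite /dual_rate !div1r invrK invf_div mul1r.
  by apply: le_of_f => //; rewrite fE ler_pdivlMr // mulrC.
(* The extra hypothesis gives [f (C T) <= f T / kappa^m] for some [C], so that
   removing [kappa^m] from the argument of [g] costs only the factor [C]. *)
move=> [gamma gamma0 fC].
have [C [C0 CK fCT]] : exists C : R, [/\ 0 < C, C `^ (- gamma) <= K^-1 &
    forall T, 0 < T -> f (C * T) <= C `^ (- gamma) * f T].
  have [C0 [_ hC]] := fC.
  pose C := Num.max 1 (Num.max (C0 + 1) (K `^ gamma^-1)).
  have C1 : 1 <= C by rewrite le_max lexx.
  have Cpos : 0 < C by exact: lt_le_trans C1.
  exists C; split=> //; last first.
    apply: hC; rewrite (lt_le_trans (y := C0 + 1)) ?ltrDl //.
    by rewrite !le_max lexx orbT.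
  rewrite powRN lef_pV2 ?posrE ?powR_gt0 //.
  apply: (@le_trans _ _ ((K `^ gamma^-1) `^ gamma)).
    by rewrite -powRrM mulVf ?gt_eqF // powRr1 // ltW.
  apply: ge0_ler_powR; rewrite ?nnegrE ?powR_ge0 ?(ltW Cpos) ?(ltW gamma0) //.
  by rewrite !le_max lexx !orbT.
apply: (@BAhat_null _ _ _ Theta f _ C (Num.max `|K / f 1| `|1 / f 1|)) => //.
move=> S T; rewrite gt_max => /andP[KS S1] T0 ST.
have [S0 finvK0 fKE] := preimage _ _ K0 KS.
have [_ finv0 fE] := preimage _ _ ltr01 S1.
rewrite /dual_rate !div1r invrK -div1r.
apply: (@le_trans _ _ (C * finv (K / S))).
  apply: le_of_f; rewrite ?mulr_gt0 // (le_trans (fCT _ finvK0)) // fE fKE.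
  apply: (@le_trans _ _ (K^-1 * (K / S))).
    by rewrite ler_pM2r // divr_gt0.
  by rewrite mulKf ?gt_eqF // div1r.
rewrite ler_pM2l //; apply: le_of_f => //.
by rewrite fKE ler_pdivlMr // mulrC.
Qed.
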